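(* Let $f: \mathbb{R}^d \rightarrow \mathbb{R}^m$, $f(x) = (f_1(x), \ldots, f_m(x))$, where each $f_i$ is twice differentiable with continuous second partial derivatives. Let $S$ be the set of all vectors in $\mathbb{R}^d$ with at most $10$ non-zero coordinates, all of whose non-zero coordinates are equal to $1$. Suppose \[ 0.99 \|rx\|_{\infty} \le \|f(rx)\|_{\infty} \le 1.01 \|rx\|_{\infty} \quad \text{for all } r> 0 \text{ and all } x \in S. \] Then $m = \Omega(d)$, i.e., $m \ge c\,d$ for an absolute constant $c>0$. *)

(* Defs.v *)
(* R^n is ['rV[R]_n]; the library's norm [`|x|] on it is
   the sup-norm, max_j |x_j| (see [mx_normrE]). *)
From mathcomp Require Import all_boot all_order all_algebra.
From mathcomp Require Import all_classical all_reals all_analysis.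

Set Implicit Arguments.
Unset Strict Implicit.
Unset Printing Implicit Defensive.

Import Order.TTheory GRing.Theory Num.Theory.
Import numFieldNormedType.Exports.

Local Open Scope classical_set_scope.
Local Open Scope ring_scope.

Definition partial (R : realType) (d : nat) (j : 'I_d) (g : 'rV[R]_d -> R) :
  'rV[R]_d -> R := 'D_(delta_mx 0 j) g.

Definition gradient (R : realType) (d : nat) (g : 'rV[R]_d -> R) :
  'rV[R]_d -> 'rV[R]_d := fun x => \row_(j < d) partial j g x.

(* [partial] is a total function, with an unspecified value where the partial
   derivative does not exist; the first two conjuncts guarantee that all first
   and second partial derivatives exist.  Twice differentiable means that g and
   its derivative, represented by the gradient, are (Frechet) differentiable. *)
Definition twice_continuously_differentiable (R : realType) (d : nat)
    (g : 'rV[R]_d -> R) : Prop :=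
  [/\ forall x, differentiable g x,
      forall x, differentiable (gradient g) x &
      forall j k : 'I_d, continuous (partial k (partial j g))].

Definition sparse_indicators (R : realType) (d k : nat) : set 'rV[R]_d :=
  [set x : 'rV[R]_d | (#|[pred j : 'I_d | (x 0 j != 0)%R]| <= k)%N /\
           forall j : 'I_d, x 0 j != 0 -> x 0 j = 1].

Arguments sparse_indicators : clear implicits.

(* Main.v *)
Require Import Defs.
From mathcomp Require Import all_boot all_order all_algebra.
From mathcomp Require Import all_classical all_reals all_analysis.
From mathcomp Require Import lra.

Set Implicit Arguments.
Unset Strict Implicit.
Unset Printing Implicit Defensive.

Import Order.TTheory GRing.Theory Num.Theory.
Import numFieldNormedType.Exports.

Local Open Scope classical_set_scope.
Local Open Scope ring_scope.

(** Dividing the hypothesis by r and letting r tend to 0 shows that the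
    derivative A of f at 0 satisfies the same bounds on S.  Every A e_j then has
    an entry of absolute value at least 0.99.  No two columns can have such an
    entry in the same row with the same sign, since A (e_j + e_k) would have an
    entry of absolute value at least 1.98 > 1.01.  Hence d <= 2 m. *)

(** Since [f 0 = 0], the difference quotient is [h^-1 *: f (h *: v)]. Both bounds are homogeneous in
    [h], so they hold for it and survive the limit. *)
Lemma derive_norm_bounds (R : realFieldType) (V W : normedModType R)
    (f : V -> W) (v : V) (a b : R) :
  f 0 = 0 -> derivable f 0 v ->
  (forall r : R, 0 < r -> a * `|r *: v| <= `|f (r *: v)| <= b * `|r *: v|) ->
  a * `|v| <= `|'D_v f 0| <= b * `|v|.
Proof.
move=> f0 dfv fbounds.
have quotient_cvg : `|h^-1 *: f (h *: v)| @[h --> 0^'+] --> `|'D_v f 0|.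
  (* The bounds hold only for positive [r], so the two-sided limit is restricted to the right of
     0. *)
  apply: cvg_norm; apply: cvg_dnbhs_at_right.
  suff -> : (fun h => h^-1 *: f (h *: v)) =
      (fun h => h^-1 *: ((f \o shift 0) (h *: v) - f 0)) by [].
  by apply/funext => h; rewrite /= addr0 f0 subr0.
have near_bounds : \forall h \near 0^'+,
    a * `|v| <= `|h^-1 *: f (h *: v)| <= b * `|v|.
  near=> h; have h0 : 0 < h by near: h; exact: nbhs_right_gt.
  have := fbounds h h0; rewrite !normrZ normfV gtr0_norm //.
  by rewrite ler_pdivlMl // ler_pdivrMl // mulrCA [b * _]mulrCA.
apply/andP; split.
  by apply: (cvgr_to_ge quotient_cvg); apply: filterS near_bounds => h /andP[].
by apply: (cvgr_to_le quotient_cvg); apply: filterS near_bounds => h /andP[].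
Unshelve. all: by end_near. Qed.

Lemma ler_norm_entry (R : realFieldType) (m n : nat) (A : 'M[R]_(m, n))
    (i : 'I_m) (j : 'I_n) :
  `|A i j| <= `|A|.
Proof.
rewrite [leRHS]/Num.Def.normr /= mx_normrE.
exact: (le_bigmax _ (fun ij => `|A ij.1 ij.2|) (i, j)).
Qed.

(** A nonzero sup-norm is attained at some entry; that entry is nonzero, hence equal to 1. *)
Lemma norm_sparse_indicators (R : realType) (d k : nat) (x : 'rV[R]_d) :
  x \in sparse_indicators R d k -> x != 0 -> `|x| = 1.
Proof.
rewrite inE => -[_ x01] x0.
have nx0 : mx_norm x != 0 by rewrite (normr_eq0 x).
have [[i j] /= xE] := mx_norm_neq0 nx0.
rewrite [LHS]xE ord1 x01 ?normr1//.
by apply: contra nx0 => /eqP xj0; rewrite xE ord1 xj0 normr0.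
Qed.

Lemma delta_sparse_indicators (R : realType) (d k : nat) (j : 'I_d) :
  (0 < k)%N -> delta_mx 0 j \in sparse_indicators R d k.
Proof.
move=> k0; rewrite inE; split=> [|i]; last first.
  by rewrite mxE /=; case: (i == j); rewrite ?eqxx.
apply: leq_trans k0; apply: leq_trans (_ : #|pred1 j| <= _)%N; last by rewrite card1.
apply: subset_leq_card.
by apply/fintype.subsetP => i; rewrite !inE mxE /=; case: (i == j); rewrite ?eqxx.
Qed.

(** As [i != j], the two ones never fall on the same coordinate, where they would add up to 2. *)
Lemma deltaD_sparse_indicators (R : realType) (d k : nat) (i j : 'I_d) :
  (1 < k)%N -> i != j ->
  delta_mx 0 i + delta_mx 0 j \in sparse_indicators R d k.
Proof.
move=> k1 ij; rewrite inE; split=> [|l]; last first.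
  rewrite !mxE /=; have [->|_] := eqVneq l i; last first.
    by case: (l == j); rewrite ?add0r ?eqxx.
  by rewrite (negbTE ij) addr0.
apply: leq_trans k1; apply: leq_trans (_ : #|pred2 i j| <= _)%N; last first.
  by rewrite card2 ij.
apply: subset_leq_card; apply/fintype.subsetP => l; rewrite !inE !mxE /=.
by case: (l == i); case: (l == j); rewrite ?addr0 ?eqxx.
Qed.

(** Pigeonhole: sending [j] to the row of a large entry of [A j] and the sign of that entry is
    injective into a set of size [2 m]. *)
Lemma leq_of_large_entries (R : realDomainType) (d m : nat)
    (A : 'I_d -> 'I_m -> R) (c : R) :
  (forall j, exists i, c <= `|A j i|) ->
  (forall j k, j != k -> forall i, `|A j i + A k i| < c *+ 2) ->
  (d <= m.*2)%N.
Proof.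
move=> /choice[row rowP] small.
pose f j := (row j, 0 <= A j (row j)).
have f_inj : injective f.
  move=> j k [rjk]; rewrite rjk => sjk; apply/eqP; apply: contraT => jk.
  have := small _ _ jk (row k).
  have := rowP k; have := rowP j; rewrite rjk.
  (* Entries of equal sign do not cancel: their sum has absolute value at least [2 c]. *)
  case: (leP 0 (A j (row k))) sjk => Aj /esym Ak.
    by rewrite !ger0_norm ?addr_ge0 // mulr2n; lra.
  have {}Ak : A k (row k) < 0 by rewrite ltNge Ak.
  by rewrite !ltr0_norm // ?mulr2n; lra.
by have := leq_card f f_inj; rewrite card_prod !card_ord card_bool muln2.
Qed.

Theorem mainTheorem11 (R : realType) :
  exists2 c : R, 0 < c &
    forall (d m : nat) (f : 'rV[R]_d -> 'rV[R]_m),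
      (forall i : 'I_m,
         twice_continuously_differentiable (fun x : 'rV[R]_d => f x 0 i)) ->
      (forall (r : R) (x : 'rV[R]_d), 0 < r -> x \in sparse_indicators R d 10 ->
         99 / 100 * `|r *: x| <= `|f (r *: x)| <= 101 / 100 * `|r *: x|) ->
      c * d%:R <= m%:R.
Proof.
exists (1 / 2) => [|d m f f_diff f_bounds]; first by rewrite divr_gt0.
suff : (d <= m.*2)%N.
  by rewrite -(ler_nat R) -muln2 natrM; lra.
have diff0 i : differentiable (fun x : 'rV[R]_d => f x 0 i) 0.
  by have [] := f_diff i.
(* The zero vector lies in S, and the upper bound there forces [f 0 = 0]. *)
have S0 : 0 \in sparse_indicators R d 10.
  rewrite inE; split=> [|i]; last by rewrite mxE eqxx.
  by rewrite eq_card0 // => i; rewrite !inE mxE eqxx.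
have f0 : f 0 = 0.
  have /andP[_] := f_bounds 1 0 ltr01 S0.
  by rewrite scaler0 normr0 mulr0 normr_le0 => /eqP.
have f_derivable v : derivable f 0 v.
  by apply/derivable_mxP => i j; rewrite ord1; exact: diff_derivable.
pose D v := 'D_v f 0.
have D_bounds x : x \in sparse_indicators R d 10 ->
    99 / 100 * `|x| <= `|D x| <= 101 / 100 * `|x|.
  move=> xS; apply: derive_norm_bounds => // r r0; exact: f_bounds.
(* Each component is differentiable at 0, so its directional derivative is linear in the
   direction. *)
have D_add v w i : D (v + w) 0 i = D v 0 i + D w 0 i.
  by rewrite /D !derive_mx // !mxE !deriveE //; exact: raddfD.
have delta_neq0 j : delta_mx 0 j != 0 :> 'rV[R]_d.
  by apply/eqP => /matrixP/(_ 0 j)/eqP; rewrite !mxE !eqxx oner_eq0.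
apply: (@leq_of_large_entries R _ _ (fun j i => D (delta_mx 0 j) 0 i) (99/100)).
  move=> j; have jS := @delta_sparse_indicators R d 10 j isT.
  have /andP[+ _] := D_bounds _ jS.
  rewrite (norm_sparse_indicators jS) // mulr1 => Dj.
  have [|[i0 i] /= DjE] := @mx_norm_neq0 _ _ _ (D (delta_mx 0 j)).
    rewrite (_ : mx_norm _ = `|D (delta_mx 0 j)|) //; apply: lt0r_neq0; lra.
  by exists i; move: DjE; rewrite ord1 => <-.
move=> j k jk i; have jkS := @deltaD_sparse_indicators R d 10 j k isT jk.
have /andP[_] := D_bounds _ jkS.
rewrite -D_add; set x := _ + _ in jkS * => Dx.
(* An upper bound suffices, so the case [x = 0] is settled directly instead of being excluded. *)
have x_le1 : `|x| <= 1.
  have [->|x0] := eqVneq x 0; first by rewrite normr0.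
  by rewrite (norm_sparse_indicators jkS).
apply: le_lt_trans (ler_norm_entry _ _ _) _.
by apply: le_lt_trans Dx _; rewrite mulr2n; lra.
Qed.
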